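(* Let $\mathsf{C}$ be a partializable Markov category. Define an operation $\otimes$ on $\mathsf{Partial}(\mathsf{C})$ which on objects is the tensor product of $\mathsf{C}$ and on morphisms is $$\bigl(X\xleftarrow{i}A\xrightarrow{f}Y\bigr)\otimes\bigl(X'\xleftarrow{j}B\xrightarrow{g}Y'\bigr):=\bigl(X\otimes X'\xleftarrow{i\otimes j}A\otimes B\xrightarrow{f\otimes g}Y\otimes Y'\bigr).$$ This is well-defined, is a functor $\mathsf{Partial}(\mathsf{C})\times\mathsf{Partial}(\mathsf{C})\to\mathsf{Partial}(\mathsf{C})$, and is part of a symmetric monoidal structure on $\mathsf{Partial}(\mathsf{C})$ extending that of $\mathsf{C}$ (along the inclusion $\mathsf{C}\hookrightarrow\mathsf{Partial}(\mathsf{C})$).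
   Context: A CD category is a symmetric monoidal category $(\mathsf{C},\otimes,I)$ in which every object $X$ carries a commutative comonoid structure $\mathrm{copy}_X\colon X\to X\otimes X$, $\mathrm{del}_X\colon X\to I$, compatible with tensor products ($\mathrm{copy}_{X\otimes Y}$ is $\mathrm{copy}_X\otimes\mathrm{copy}_Y$ followed by swapping the two middle factors, and $\mathrm{del}_{X\otimes Y}=\mathrm{del}_X\otimes\mathrm{del}_Y$) and with $\mathrm{copy}_I=\mathrm{del}_I=\mathrm{id}_I$; coherence isomorphisms are suppressed. A morphism $f\colon X\to Y$ is total if $\mathrm{del}_Y\circ f=\mathrm{del}_X$, copyable if $\mathrm{copy}_Y\circ f=(f\otimes f)\circ\mathrm{copy}_X$, and deterministic if it is both. A Markov category is a CD category in which every morphism is total. A Markov category is positive if for all $u\colon X\to Y$, $v\colon Y\to Z$ with $v\circ u$ deterministic, $(u\otimes (v\circ u))\circ\mathrm{copy}_X=(\mathrm{id}_Y\otimes v)\circ\mathrm{copy}_Y\circ u$. A Markov category $\mathsf{C}$ is partializable if: (i) it is positive; (ii) pullbacks of deterministic monomorphisms along arbitrary morphisms exist and are themselves deterministic (monomorphisms); (iii) if $i\colon D\to X$ is a deterministic monomorphism then $i\otimes\mathrm{id}_A$ is a monomorphism for every object $A$. For $\mathsf{C}$ partializable, the category $\mathsf{Partial}(\mathsf{C})$ has the objects of $\mathsf{C}$; its morphisms $X\to Y$ are equivalence classes of spans $X\xleftarrow{i}D\xrightarrow{f}Y$ (also written $(D,i,f)$) in $\mathsf{C}$ with $i$ a deterministic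 monomorphism, where $(D,i,f)\sim(D',i',f')$ iff there is an isomorphism $t\colon D\to D'$ with $i'\circ t=i$, $f'\circ t=f$. The composite of $(A,i,f)\colon X\to Y$ followed by $(B,j,g)\colon Y\to Z$ is $(C,i\circ u,g\circ v)$, where $A\xleftarrow{u}C\xrightarrow{v}B$ is the pullback of $f$ and $j$. The inclusion $\mathsf{C}\hookrightarrow\mathsf{Partial}(\mathsf{C})$ is the identity on objects and sends $f\colon X\to Y$ to $(X,\mathrm{id}_X,f)$. *)

(* Defs.v *)
From Stdlib Require Import FunctionalExtensionality PropExtensionality ProofIrrelevance.

Set Implicit Arguments.
Unset Strict Implicit.
Unset Printing Implicit Defensive.

Declare Scope cat_scope.
Delimit Scope cat_scope with cat.
Open Scope cat_scope.

(* ---------------------------------------------------------------- *)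
(* Categories and functors; equality of morphisms is Leibniz equality *)

Record Category := {
  obj :> Type;
  hom : obj -> obj -> Type;
  idm : forall X, hom X X;
  comp : forall X Y Z, hom Y Z -> hom X Y -> hom X Z;
  comp_id_l : forall X Y (f : hom X Y), comp (idm Y) f = f;
  comp_id_r : forall X Y (f : hom X Y), comp f (idm X) = f;
  comp_assoc : forall W X Y Z (h : hom Y Z) (g : hom X Y) (f : hom W X),
    comp h (comp g f) = comp (comp h g) f
}.

Arguments hom {c} X Y.
Arguments idm {c} X.
Arguments comp {c X Y Z} g f.

Notation "g ∘ f" := (comp g f) (at level 40, left associativity) : cat_scope.

Definition is_mono (C : Category) (X Y : C) (f : hom X Y) : Prop :=
  forall (W : C) (a b : hom W X), f ∘ a = f ∘ b -> a = b.

Record Iso (C : Category) (X Y : C) := {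
  fwd : hom X Y;
  bwd : hom Y X;
  bwd_fwd : bwd ∘ fwd = idm X;
  fwd_bwd : fwd ∘ bwd = idm Y
}.

(*      W --v--> B
        |u       |j
        A --f--> Y      *)
Definition is_pullback (C : Category) (W A B Y : C)
    (f : hom A Y) (j : hom B Y) (u : hom W A) (v : hom W B) : Prop :=
  f ∘ u = j ∘ v /\
  forall (V : C) (a : hom V A) (b : hom V B), f ∘ a = j ∘ b ->
    exists! c : hom V W, u ∘ c = a /\ v ∘ c = b.

Program Definition prod_cat (A B : Category) : Category := {|
  obj := (A * B)%type;
  hom := fun p q => (hom (fst p) (fst q) * hom (snd p) (snd q))%type;
  idm := fun p => (idm (fst p), idm (snd p));
  comp := fun _ _ _ g f => (fst g ∘ fst f, snd g ∘ snd f)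
|}.
Next Obligation. now rewrite !comp_id_l. Qed.
Next Obligation. now rewrite !comp_id_r. Qed.
Next Obligation. now rewrite !comp_assoc. Qed.

(* The object map is a parameter, so that prescribing the value of a functor
   on objects needs no transport along equalities of objects. *)
Record FunctorOn (A B : Category) (F : A -> B) := {
  fmap : forall X Y, hom X Y -> hom (F X) (F Y);
  fmap_id : forall X, fmap (idm X) = idm (F X);
  fmap_comp : forall X Y Z (g : hom Y Z) (f : hom X Y),
    fmap (g ∘ f) = fmap g ∘ fmap f
}.

Definition BifunctorOn (C : Category) (tens : C -> C -> C) :=
  @FunctorOn (prod_cat C C) C (fun p => tens (fst p) (snd p)).

Definition bimap (C : Category) (tens : C -> C -> C) (T : BifunctorOn tens)
    (X Y X' Y' : C) (f : hom X Y) (g : hom X' Y') :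
    hom (tens X X') (tens Y Y') :=
  @fmap _ _ _ T (X, X') (Y, Y') (f, g).

(* ---------------------------------------------------------------- *)
(* Symmetric monoidal categories (not assumed strict) *)

Record SymMonoidal (C : Category) (tens : C -> C -> C)
    (T : BifunctorOn tens) (I : C) := {
  assoc : forall X Y Z, Iso (tens (tens X Y) Z) (tens X (tens Y Z));
  lunit : forall X, Iso (tens I X) X;
  runit : forall X, Iso (tens X I) X;
  swap : forall X Y, hom (tens X Y) (tens Y X);
  assoc_nat : forall X Y Z X' Y' Z' (f : hom X X') (g : hom Y Y') (h : hom Z Z'),
    fwd (assoc X' Y' Z') ∘ bimap T (bimap T f g) h
    = bimap T f (bimap T g h) ∘ fwd (assoc X Y Z);
  lunit_nat : forall X Y (f : hom X Y),
    fwd (lunit Y) ∘ bimap T (idm I) f = f ∘ fwd (lunit X);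
  runit_nat : forall X Y (f : hom X Y),
    fwd (runit Y) ∘ bimap T f (idm I) = f ∘ fwd (runit X);
  swap_nat : forall X Y X' Y' (f : hom X X') (g : hom Y Y'),
    swap X' Y' ∘ bimap T f g = bimap T g f ∘ swap X Y;
  pentagon : forall W X Y Z,
    fwd (assoc W X (tens Y Z)) ∘ fwd (assoc (tens W X) Y Z)
    = bimap T (idm W) (fwd (assoc X Y Z)) ∘ fwd (assoc W (tens X Y) Z)
      ∘ bimap T (fwd (assoc W X Y)) (idm Z);
  triangle : forall X Y,
    bimap T (idm X) (fwd (lunit Y)) ∘ fwd (assoc X I Y)
    = bimap T (fwd (runit X)) (idm Y);
  swap_swap : forall X Y, swap Y X ∘ swap X Y = idm (tens X Y);
  hexagon : forall X Y Z,
    fwd (assoc Y Z X) ∘ swap X (tens Y Z) ∘ fwd (assoc X Y Z)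
    = bimap T (idm Y) (swap X Z) ∘ fwd (assoc Y X Z)
      ∘ bimap T (swap X Y) (idm Z)
}.

Record SymMonoidalCategory := {
  smc_cat :> Category;
  tens : smc_cat -> smc_cat -> smc_cat;
  tensor : BifunctorOn tens;
  unit : smc_cat;
  smc_str : SymMonoidal tensor unit
}.

Arguments tens {s} X Y.
Arguments tensor {s}.
Arguments unit {s}.
Arguments smc_str {s}.

Notation "X ⊗ Y" := (tens X Y) (at level 38, left associativity) : cat_scope.
Notation "f ⊠ g" := (bimap tensor f g) (at level 38, left associativity) : cat_scope.

Section Structure.
Context {C : SymMonoidalCategory}.
Definition α (X Y Z : C) : Iso ((X ⊗ Y) ⊗ Z) (X ⊗ (Y ⊗ Z)) := assoc smc_str X Y Z.
Definition λ (X : C) : Iso (unit ⊗ X) X := lunit smc_str X.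
Definition ρ (X : C) : Iso (X ⊗ unit) X := runit smc_str X.
Definition σ (X Y : C) : hom (X ⊗ Y) (Y ⊗ X) := swap smc_str X Y.

Definition middle_swap (X Y : C) : hom ((X ⊗ X) ⊗ (Y ⊗ Y)) ((X ⊗ Y) ⊗ (X ⊗ Y)) :=
  bwd (α X Y (X ⊗ Y))
  ∘ (idm X ⊠ (fwd (α Y X Y) ∘ (σ X Y ⊠ idm Y) ∘ bwd (α X Y Y)))
  ∘ fwd (α X X (Y ⊗ Y)).
End Structure.

(* ---------------------------------------------------------------- *)
(* CD categories and Markov categories *)

Record CDCategory := {
  cd_smc :> SymMonoidalCategory;
  copy : forall X : cd_smc, hom X (X ⊗ X);
  del : forall X : cd_smc, hom X unit;
  copy_coassoc : forall X,
    fwd (α X X X) ∘ (copy X ⊠ idm X) ∘ copy X = (idm X ⊠ copy X) ∘ copy X;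
  copy_counit_l : forall X, fwd (λ X) ∘ (del X ⊠ idm X) ∘ copy X = idm X;
  copy_counit_r : forall X, fwd (ρ X) ∘ (idm X ⊠ del X) ∘ copy X = idm X;
  copy_comm : forall X, σ X X ∘ copy X = copy X;
  copy_tens : forall X Y, copy (X ⊗ Y) = middle_swap X Y ∘ (copy X ⊠ copy Y);
  del_tens : forall X Y, del (X ⊗ Y) = fwd (λ unit) ∘ (del X ⊠ del Y);
  copy_unit : copy unit = bwd (λ unit);
  del_unit : del unit = idm unit
}.

Arguments copy {c} X.
Arguments del {c} X.

Definition total (C : CDCategory) (X Y : C) (f : hom X Y) : Prop :=
  del Y ∘ f = del X.

Definition copyable (C : CDCategory) (X Y : C) (f : hom X Y) : Prop :=
  copy Y ∘ f = (f ⊠ f) ∘ copy X.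

Definition deterministic (C : CDCategory) (X Y : C) (f : hom X Y) : Prop :=
  total f /\ copyable f.

Record MarkovCategory := {
  markov_cd :> CDCategory;
  all_total : forall (X Y : markov_cd) (f : hom X Y), total f
}.

Definition positive (C : MarkovCategory) : Prop :=
  forall (X Y Z : C) (u : hom X Y) (v : hom Y Z), deterministic (v ∘ u) ->
    (u ⊠ (v ∘ u)) ∘ copy X = (idm Y ⊠ v) ∘ copy Y ∘ u.

Definition det_mono (C : CDCategory) (X Y : C) (i : hom X Y) : Prop :=
  deterministic i /\ is_mono i.

Record partializable (C : MarkovCategory) : Prop := {
  part_positive : positive C;
  part_pullback_ex : forall (A B Y : C) (f : hom A Y) (j : hom B Y), det_mono j ->
    exists (W : C) (u : hom W A) (v : hom W B), is_pullback f j u v;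
  part_pullback_det : forall (W A B Y : C) (f : hom A Y) (j : hom B Y)
    (u : hom W A) (v : hom W B), det_mono j -> is_pullback f j u v -> det_mono u;
  part_tens_mono : forall (D X : C) (i : hom D X), det_mono i ->
    forall A : C, is_mono (i ⊠ idm A)
}.

(* ---------------------------------------------------------------- *)
(* Spans whose left leg is a deterministic monomorphism *)

Record Span (C : MarkovCategory) (X Y : C) := {
  apex : C;
  lleg : hom apex X;
  rleg : hom apex Y;
  lleg_det_mono : det_mono lleg
}.

Definition span_equiv (C : MarkovCategory) (X Y : C) (s s' : Span X Y) : Prop :=
  exists t : Iso (apex s) (apex s'),
    lleg s' ∘ fwd t = lleg s /\ rleg s' ∘ fwd t = rleg s.

Definition is_composite (C : MarkovCategory) (X Y Z : C)
    (s : Span X Y) (t : Span Y Z) (w : Span X Z) : Prop :=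
  exists (u : hom (apex w) (apex s)) (v : hom (apex w) (apex t)),
    is_pullback (rleg s) (lleg t) u v /\
    lleg w = lleg s ∘ u /\ rleg w = rleg t ∘ v.

(* Equivalence classes of spans, as subsets of the type of spans *)
Definition PHom (C : MarkovCategory) (X Y : C) : Type :=
  { P : Span X Y -> Prop | exists s, P = span_equiv s }.

Definition cls (C : MarkovCategory) (X Y : C) (s : Span X Y) : PHom X Y :=
  exist _ (span_equiv s) (ex_intro _ s eq_refl).

Section Spans.
Variable C : MarkovCategory.

Lemma span_equiv_refl (X Y : C) (s : Span X Y) : span_equiv s s.
Proof.
unshelve eexists. { exists (idm _) (idm _); apply comp_id_l. }
simpl; split; apply comp_id_r.
Qed.

Lemma span_equiv_sym (X Y : C) (s t : Span X Y) : span_equiv s t -> span_equiv t s.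
Proof.
intros [k [h1 h2]].
exists (Build_Iso (fwd_bwd k) (bwd_fwd k)); simpl.
rewrite <- h1, <- h2, <- !comp_assoc, !fwd_bwd, !comp_id_r; auto.
Qed.

Lemma span_equiv_trans (X Y : C) (s t w : Span X Y) :
  span_equiv s t -> span_equiv t w -> span_equiv s w.
Proof.
intros [k [h1 h2]] [l [h3 h4]].
unshelve eexists.
{ exists (fwd l ∘ fwd k) (bwd k ∘ bwd l).
  - rewrite comp_assoc, <- (comp_assoc (bwd k)), bwd_fwd, comp_id_r; apply bwd_fwd.
  - rewrite comp_assoc, <- (comp_assoc (fwd l)), fwd_bwd, comp_id_r; apply fwd_bwd. }
simpl; rewrite !comp_assoc, h3, h4; auto.
Qed.

Lemma PHom_ext (X Y : C) (P Q : PHom X Y) :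
  (forall s, proj1_sig P s <-> proj1_sig Q s) -> P = Q.
Proof.
destruct P as [P hP], Q as [Q hQ]; simpl; intros H.
assert (E : P = Q).
{ apply functional_extensionality; intros s; apply propositional_extensionality, H. }
subst Q; f_equal; apply proof_irrelevance.
Qed.

Lemma cls_eq (X Y : C) (s t : Span X Y) : cls s = cls t <-> span_equiv s t.
Proof.
split.
- intros H; apply (f_equal (fun P => proj1_sig P t)) in H; simpl in H.
  rewrite H; apply span_equiv_refl.
- intros H; apply PHom_ext; intros w; simpl; split; intros H'.
  + eapply span_equiv_trans; [apply span_equiv_sym|]; eassumption.
  + eapply span_equiv_trans; eassumption.
Qed.

Lemma cls_ind (X Y : C) (P : PHom X Y) : exists s, P = cls s.
Proof.
destruct P as [P [s ->]]; exists s; apply PHom_ext; reflexivity.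
Qed.

Lemma is_mono_idm (K : Category) (X : K) : is_mono (idm X).
Proof. intros W a b; rewrite !comp_id_l; auto. Qed.

Lemma is_mono_comp (K : Category) (X Y Z : K) (g : hom Y Z) (f : hom X Y) :
  is_mono g -> is_mono f -> is_mono (g ∘ f).
Proof. intros hg hf W a b h; apply hf, hg; rewrite !comp_assoc; exact h. Qed.

Lemma bimap_id (K : Category) (tn : K -> K -> K) (T : BifunctorOn tn) (X Y : K) :
  bimap T (idm X) (idm Y) = idm (tn X Y).
Proof. exact (fmap_id T (X, Y)). Qed.

Lemma bimap_comp (K : Category) (tn : K -> K -> K) (T : BifunctorOn tn)
    (X Y Z X' Y' Z' : K) (g : hom Y Z) (f : hom X Y) (g' : hom Y' Z') (f' : hom X' Y') :
  bimap T (g ∘ f) (g' ∘ f') = bimap T g g' ∘ bimap T f f'.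
Proof.
exact (@fmap_comp _ _ _ T (X, X') (Y, Y') (Z, Z') (g, g') (f, f')).
Qed.

Lemma det_mono_idm (X : C) : det_mono (idm X).
Proof.
repeat split.
- apply all_total.
- unfold copyable; now rewrite bimap_id, comp_id_l, comp_id_r.
- apply is_mono_idm.
Qed.

Lemma det_mono_comp (X Y Z : C) (g : hom Y Z) (f : hom X Y) :
  det_mono g -> det_mono f -> det_mono (g ∘ f).
Proof.
intros [[_ cg] mg] [[_ cf] mf]; repeat split.
- apply all_total.
- unfold copyable in *.
  now rewrite comp_assoc, cg, <- comp_assoc, cf, comp_assoc, bimap_comp.
- now apply is_mono_comp.
Qed.

Lemma is_composite_uniq (X Y Z : C) (s s' : Span X Y) (t t' : Span Y Z) (w w' : Span X Z) :
  span_equiv s s' -> span_equiv t t' ->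
  is_composite s t w -> is_composite s' t' w' -> span_equiv w w'.
Proof.
intros [k [k1 k2]] [l [l1 l2]] [u [v [[e p] [h1 h2]]]] [u' [v' [[e' p'] [h1' h2']]]].
destruct (p' _ (fwd k ∘ u) (fwd l ∘ v)) as [c [[c1 c2] _]].
{ now rewrite !comp_assoc, k2, l1. }
assert (k2' : rleg s ∘ bwd k = rleg s').
{ now rewrite <- k2, <- comp_assoc, fwd_bwd, comp_id_r. }
assert (l1' : lleg t ∘ bwd l = lleg t').
{ now rewrite <- l1, <- comp_assoc, fwd_bwd, comp_id_r. }
destruct (p _ (bwd k ∘ u') (bwd l ∘ v')) as [d [[d1 d2] _]].
{ now rewrite !comp_assoc, k2', l1'. }
unshelve eexists.
{ exists c d.
  - destruct (p _ u v e) as [x [_ hx]]. rewrite <- (hx (d ∘ c)), <- (hx (idm _)); auto.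
    + rewrite !comp_id_r; auto.
    + rewrite !comp_assoc, d1, d2, <- !comp_assoc, c1, c2, !comp_assoc, !bwd_fwd, !comp_id_l; auto.
  - destruct (p' _ u' v' e') as [x [_ hx]]. rewrite <- (hx (c ∘ d)), <- (hx (idm _)); auto.
    + rewrite !comp_id_r; auto.
    + rewrite !comp_assoc, c1, c2, <- !comp_assoc, d1, d2, !comp_assoc, !fwd_bwd, !comp_id_l; auto. }
simpl; rewrite h1', h2', <- !comp_assoc, c1, c2, !comp_assoc, k1, l2; auto.
Qed.

Lemma is_composite_equiv (X Y Z : C) (s : Span X Y) (t : Span Y Z) (w w' : Span X Z) :
  span_equiv w w' -> is_composite s t w -> is_composite s t w'.
Proof.
intros [k [k1 k2]] [u [v [[e p] [h1 h2]]]].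
exists (u ∘ bwd k), (v ∘ bwd k); split; [split|split].
- now rewrite !comp_assoc, e.
- intros V a b h; destruct (p V a b h) as [c [[c1 c2] hc]].
  exists (fwd k ∘ c); split.
  + rewrite !comp_assoc, <- !(comp_assoc _ (bwd k)), bwd_fwd, !comp_id_r; auto.
  + intros d [d1 d2]. rewrite (hc (bwd k ∘ d)), comp_assoc, fwd_bwd, comp_id_l; auto.
    rewrite !comp_assoc; auto.
- now rewrite comp_assoc, <- h1, <- k1, <- comp_assoc, fwd_bwd, comp_id_r.
- now rewrite comp_assoc, <- h2, <- k2, <- comp_assoc, fwd_bwd, comp_id_r.
Qed.

Hypothesis HC : partializable C.

Lemma is_composite_ex (X Y Z : C) (s : Span X Y) (t : Span Y Z) :
  exists w, is_composite s t w.
Proof.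
destruct (part_pullback_ex HC (rleg s) (lleg_det_mono t)) as [W [u [v p]]].
unshelve eexists.
{ refine (@Build_Span C X Z W (lleg s ∘ u) (rleg t ∘ v) _).
  apply det_mono_comp; [apply lleg_det_mono|].
  eapply (part_pullback_det HC); [apply (lleg_det_mono t)|exact p]. }
exists u, v; auto.
Qed.

(* The set of all spans that are composites of representatives; the choice of
   pullback does not matter, see cls_pcomp. *)
Definition pcomp_rel (X Y Z : C) (Q : PHom Y Z) (P : PHom X Y) (w : Span X Z) : Prop :=
  exists s t, proj1_sig P s /\ proj1_sig Q t /\ is_composite s t w.

Lemma pcomp_rel_cls (X Y Z : C) (s : Span X Y) (t : Span Y Z) (w : Span X Z) :
  is_composite s t w -> pcomp_rel (cls t) (cls s) = span_equiv w.
Proof.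
intros h; apply functional_extensionality; intros w'.
apply propositional_extensionality; split.
- intros [s' [t' [h1 [h2 h3]]]]; exact (is_composite_uniq h1 h2 h h3).
- intros h'; exists s, t; repeat split; try apply span_equiv_refl.
  eapply is_composite_equiv; eassumption.
Qed.

Lemma pcomp_class (X Y Z : C) (Q : PHom Y Z) (P : PHom X Y) :
  exists w, pcomp_rel Q P = span_equiv w.
Proof.
destruct (cls_ind P) as [s ->], (cls_ind Q) as [t ->].
destruct (is_composite_ex s t) as [w h]; exists w; now apply pcomp_rel_cls.
Qed.

Definition pcomp (X Y Z : C) (Q : PHom Y Z) (P : PHom X Y) : PHom X Z :=
  exist _ (pcomp_rel Q P) (pcomp_class Q P).

Lemma cls_pcomp (X Y Z : C) (s : Span X Y) (t : Span Y Z) (w : Span X Z) :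
  is_composite s t w -> pcomp (cls t) (cls s) = cls w.
Proof.
intros h; apply PHom_ext; intros w'; simpl; now rewrite (pcomp_rel_cls h).
Qed.

Definition incl_span (X Y : C) (f : hom X Y) : Span X Y :=
  {| apex := X; lleg := idm X; rleg := f; lleg_det_mono := det_mono_idm X |}.

Lemma pcomp_id_l (X Y : C) (P : PHom X Y) : pcomp (cls (incl_span (idm Y))) P = P.
Proof.
destruct (cls_ind P) as [s ->]; apply cls_pcomp.
exists (idm _), (rleg s); repeat split; simpl;
  rewrite ?comp_id_l, ?comp_id_r; auto.
intros V a b; rewrite comp_id_l; intros h; exists a; split.
- rewrite comp_id_l; auto.
- intros x [hx _]; now rewrite comp_id_l in hx.
Qed.

Lemma pcomp_id_r (X Y : C) (P : PHom X Y) : pcomp P (cls (incl_span (idm X))) = P.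
Proof.
destruct (cls_ind P) as [s ->]; apply cls_pcomp.
exists (lleg s), (idm _); repeat split; simpl;
  rewrite ?comp_id_l, ?comp_id_r; auto.
intros V a b; rewrite comp_id_l; intros h; exists b; split.
- rewrite comp_id_l; auto.
- intros x [_ hx]; now rewrite comp_id_l in hx.
Qed.

Lemma pcomp_assoc (W X Y Z : C) (R : PHom Y Z) (Q : PHom X Y) (P : PHom W X) :
  pcomp R (pcomp Q P) = pcomp (pcomp R Q) P.
Proof.
destruct (cls_ind P) as [s ->], (cls_ind Q) as [t ->], (cls_ind R) as [r ->].
destruct (is_composite_ex s t) as [st hst].
destruct (is_composite_ex t r) as [tr htr].
destruct (is_composite_ex st r) as [w hw].
rewrite (cls_pcomp hst), (cls_pcomp htr), (cls_pcomp hw).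
symmetry; apply cls_pcomp.
destruct hst as [u1 [v1 [[e1 p1] [a1 b1]]]].
destruct htr as [u2 [v2 [[e2 p2] [a2 b2]]]].
destruct hw as [u3 [v3 [[e3 p3] [a3 b3]]]].
destruct (p2 _ (v1 ∘ u3) v3) as [c [[c1 c2] hc]].
{ rewrite comp_assoc, <- b1; exact e3. }
exists (u1 ∘ u3), c; split; [split|split].
- now rewrite a2, comp_assoc, e1, <- !comp_assoc, c1.
- intros V a b h.
  destruct (p1 V a (u2 ∘ b)) as [x [[x1 x2] hx]].
  { now rewrite h, a2, comp_assoc. }
  destruct (p3 V x (v2 ∘ b)) as [y [[y1 y2] hy]].
  { now rewrite b1, <- comp_assoc, x2, comp_assoc, e2, comp_assoc. }
  exists y; split.
  + split; [now rewrite <- comp_assoc, y1|].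
    destruct (p2 V (u2 ∘ b) (v2 ∘ b)) as [z [_ hz]].
    { now rewrite !comp_assoc, e2. }
    rewrite <- (hz (c ∘ y)), <- (hz b); auto.
    rewrite !comp_assoc, c1, c2, <- comp_assoc, y1; auto.
  + intros y' [q1 q2]; apply hy; split.
    * symmetry; apply hx; split; [now rewrite comp_assoc|].
      now rewrite comp_assoc, <- c1, <- comp_assoc, q2.
    * now rewrite <- c2, <- comp_assoc, q2.
- now rewrite a3, a1, comp_assoc.
- now rewrite b3, b2, <- comp_assoc, c2.
Qed.

Definition Partial : Category := {|
  obj := obj C;
  hom := @PHom C;
  idm := fun X => cls (incl_span (idm X));
  comp := pcomp;
  comp_id_l := pcomp_id_l;
  comp_id_r := pcomp_id_r;
  comp_assoc := pcomp_assoc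
|}.

Lemma incl_comp (X Y Z : C) (g : hom Y Z) (f : hom X Y) :
  cls (incl_span (g ∘ f)) = pcomp (cls (incl_span g)) (cls (incl_span f)).
Proof.
symmetry; apply cls_pcomp.
exists (idm _), f; repeat split; simpl; rewrite ?comp_id_l, ?comp_id_r; auto.
intros V a b; rewrite comp_id_l; intros h; exists a; split.
- rewrite comp_id_l; auto.
- intros x [hx _]; now rewrite comp_id_l in hx.
Qed.

Definition incl : @FunctorOn C Partial (fun X => X) := {|
  fmap := fun (X Y : C) (f : hom X Y) => cls (incl_span f) : @hom Partial X Y;
  fmap_id := fun X => eq_refl;
  fmap_comp := incl_comp
|}.

End Spans.

Arguments incl {C} HC.

(* ---------------------------------------------------------------- *)
(* The tensor product of spans *)

Definition tensor_preserves_det_mono (C : CDCategory) : Prop :=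
  forall (A X B X' : C) (i : hom A X) (j : hom B X'),
    det_mono i -> det_mono j -> det_mono (i ⊠ j).

Definition tensor_span (C : MarkovCategory) (H : tensor_preserves_det_mono C)
    (X Y X' Y' : C) (s : Span X Y) (t : Span X' Y') : Span (X ⊗ X') (Y ⊗ Y') :=
  {| apex := apex s ⊗ apex t;
     lleg := lleg s ⊠ lleg t;
     rleg := rleg s ⊠ rleg t;
     lleg_det_mono := H _ _ _ _ _ _ (lleg_det_mono s) (lleg_det_mono t) |}.

(* The inclusion of C, which is the identity on objects, is a strict symmetric
   monoidal functor; equality of the object parts is built into the types. *)
Record extends_along_incl (C : MarkovCategory) (HC : partializable C)
    (T : @BifunctorOn (Partial HC) (@tens C))
    (M : @SymMonoidal (Partial HC) (@tens C) T (@unit C)) : Prop := {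
  ext_tensor : forall (X Y X' Y' : C) (f : hom X Y) (g : hom X' Y'),
    fmap (incl HC) (f ⊠ g) = bimap T (fmap (incl HC) f) (fmap (incl HC) g);
  ext_assoc : forall X Y Z : C,
    fwd (assoc M X Y Z) = fmap (incl HC) (fwd (α X Y Z));
  ext_lunit : forall X : C, fwd (lunit M X) = fmap (incl HC) (fwd (λ X));
  ext_runit : forall X : C, fwd (runit M X) = fmap (incl HC) (fwd (ρ X));
  ext_swap : forall X Y : C, swap M X Y = fmap (incl HC) (σ X Y)
}.

(* Main.v *)
Require Import Defs.

Set Implicit Arguments.
Unset Strict Implicit.
Unset Printing Implicit Defensive.

(** The only step that is not formal is the compatibility of the tensor product
    with composition, and composition is by pullback: given pullbacks [u] of [j]
    along [f] and [u'] of [j'] along [f'], where [j] and [j'] are deterministic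
    monomorphisms, the tensor product of the two squares has to be a pullback
    again ([is_pullback_tensor]).  Since [u ⊠ u'] and [j ⊠ j'] are monomorphisms,
    this reduces to factoring through [u ⊠ u'] every [h] for which
    [(f ⊠ f') ∘ h] factors through [j ⊠ j'].  For deterministic [h] this is easy:
    such an [h] is the pairing of its two marginals ([deterministic_pairing]),
    the marginals of [(f ⊠ f') ∘ h] factor through [j] and [j'], so the marginals
    of [h] factor through [u] and [u'], and pairing the two factorizations gives
    the one wanted.  The general case follows because the pullback of [j ⊠ j']
    along [f ⊠ f'] exists, its leg into the domain of [f ⊠ f'] is deterministic,
    and every [h] as above factors through that leg.

    That deterministic morphisms are the pairing of their marginals comes from
    the fact that copying [X ⊗ Y] and then discarding the second [X] and the
    first [Y] does nothing.  The reason is that these two discarded factors are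
    the ones that [middle_swap] exchanges, so after discarding it becomes an
    exchange of two copies of the unit, which is trivial
    ([marginals_copy]).

    The rest of the structure is transported along the inclusion.  Since the
    inclusion is functorial and respects the tensor product, all equations
    between structure morphisms hold in [Partial HC] because they hold in [C].
    Naturality with respect to partial morphisms holds because a commutative
    square two opposite sides of which are isomorphisms is a pullback
    ([incl_nat]). *)

(** * Isomorphisms and the interchange of tensor factors *)

Lemma bwd_nat (K : Category) (X Y X' Y' : K) (k : Iso X Y) (k' : Iso X' Y')
    (f : hom X X') (g : hom Y Y') :
  fwd k' ∘ f = g ∘ fwd k -> bwd k' ∘ g = f ∘ bwd k.
Proof.
intros h.
rewrite <- (comp_id_l (f ∘ bwd k)), <- (bwd_fwd k'), <- comp_assoc.
now rewrite (comp_assoc (fwd k')), h, <- (comp_assoc g), fwd_bwd, comp_id_r.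
Qed.

Lemma is_pullback_iso (K : Category) (W A B Y : K) (f : Iso A Y) (j : hom B Y)
    (u : hom W A) (v : Iso W B) :
  fwd f ∘ u = j ∘ fwd v -> is_pullback (fwd f) j u (fwd v).
Proof.
intros e; split; [exact e|]; intros V a b h.
exists (bwd v ∘ b); split; [split|].
- now rewrite comp_assoc, <- (bwd_nat e), <- comp_assoc, <- h, comp_assoc,
    bwd_fwd, comp_id_l.
- now rewrite comp_assoc, fwd_bwd, comp_id_l.
- intros c [_ <-]; now rewrite comp_assoc, bwd_fwd, comp_id_l.
Qed.

Section Interchange.
Context {C : SymMonoidalCategory}.

Definition swap_left (X Y Z : C) : hom (X ⊗ (Y ⊗ Z)) (Y ⊗ (X ⊗ Z)) :=
  fwd (α Y X Z) ∘ (σ X Y ⊠ idm Z) ∘ bwd (α X Y Z).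

(** [middle_swap] with four independent factors, which is the form in which it
    is natural. *)
Definition interchange (X Y Z W : C) :
    hom ((X ⊗ Y) ⊗ (Z ⊗ W)) ((X ⊗ Z) ⊗ (Y ⊗ W)) :=
  bwd (α X Z (Y ⊗ W)) ∘ (idm X ⊠ swap_left Y Z W) ∘ fwd (α X Y (Z ⊗ W)).

Lemma α_nat (X Y Z X' Y' Z' : C)
    (f : hom X X') (g : hom Y Y') (h : hom Z Z') :
  fwd (α X' Y' Z') ∘ ((f ⊠ g) ⊠ h) = (f ⊠ (g ⊠ h)) ∘ fwd (α X Y Z).
Proof. apply assoc_nat. Qed.

Lemma σ_nat (X Y X' Y' : C) (f : hom X X') (g : hom Y Y') :
  σ X' Y' ∘ (f ⊠ g) = (g ⊠ f) ∘ σ X Y.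
Proof. apply swap_nat. Qed.

Lemma swap_left_nat (X Y Z X' Y' Z' : C)
    (f : hom X X') (g : hom Y Y') (h : hom Z Z') :
  swap_left X' Y' Z' ∘ (f ⊠ (g ⊠ h)) = (g ⊠ (f ⊠ h)) ∘ swap_left X Y Z.
Proof.
unfold swap_left.
rewrite <- comp_assoc, (bwd_nat (α_nat f g h)), comp_assoc.
rewrite <- (comp_assoc (fwd _)), <- bimap_comp, comp_id_l.
rewrite σ_nat.
rewrite <- (comp_id_r h) at 1.
rewrite bimap_comp, comp_assoc.
rewrite α_nat.
now rewrite !comp_assoc.
Qed.

Lemma interchange_nat (X Y Z W X' Y' Z' W' : C)
    (f : hom X X') (g : hom Y Y') (h : hom Z Z') (k : hom W W') :
  interchange X' Y' Z' W' ∘ ((f ⊠ g) ⊠ (h ⊠ k))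
  = ((f ⊠ h) ⊠ (g ⊠ k)) ∘ interchange X Y Z W.
Proof.
unfold interchange.
rewrite <- comp_assoc.
rewrite α_nat.
rewrite comp_assoc, <- (comp_assoc (bwd _)), <- bimap_comp, comp_id_l.
rewrite swap_left_nat.
rewrite <- (comp_id_r f) at 1.
rewrite bimap_comp, comp_assoc.
rewrite (bwd_nat (α_nat f h (g ⊠ k))).
now rewrite !comp_assoc.
Qed.

Lemma interchange_unit (X W : C) :
  σ (unit : C) unit = idm _ -> interchange X unit unit W = idm _.
Proof.
intros e; unfold interchange, swap_left.
now rewrite e, bimap_id, comp_id_r, fwd_bwd, bimap_id, comp_id_r, bwd_fwd.
Qed.

Lemma is_mono_tensor_swap (D X A : C) (i : hom D X) :
  is_mono (i ⊠ idm A) -> is_mono (idm A ⊠ i).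
Proof.
intros hi V a b e.
assert (q : forall c : hom V (A ⊗ D), (i ⊠ idm A) ∘ (σ A D ∘ c)
  = σ A X ∘ ((idm A ⊠ i) ∘ c)).
{ intros c; rewrite !comp_assoc; now rewrite σ_nat. }
assert (e' : σ A D ∘ a = σ A D ∘ b).
{ apply hi; now rewrite !q, e. }
apply (f_equal (comp (σ D A))) in e'; rewrite !comp_assoc in e'.
unfold σ in e'; now rewrite swap_swap, !comp_id_l in e'.
Qed.
End Interchange.

(** * Marginals and pairings *)

Section Marginals.
Context {C : CDCategory}.

Definition marginal_l (X Y : C) : hom (X ⊗ Y) X := fwd (ρ X) ∘ (idm X ⊠ del Y).
Definition marginal_r (X Y : C) : hom (X ⊗ Y) Y := fwd (λ Y) ∘ (del X ⊠ idm Y).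

(** Copying the unit is invertible, so commutativity of that copy pins down the
    symmetry. *)
Lemma swap_unit : σ (unit : C) unit = idm _.
Proof.
generalize (copy_comm (unit : C)); rewrite copy_unit; intros h.
apply (f_equal (fun x => x ∘ fwd (λ unit))) in h.
now rewrite <- comp_assoc, bwd_fwd, comp_id_r in h.
Qed.

Lemma marginals_copy (X Y : C) :
  (marginal_l X Y ⊠ marginal_r X Y) ∘ copy (X ⊗ Y) = idm (X ⊗ Y).
Proof.
rewrite copy_tens; unfold marginal_l, marginal_r.
change (middle_swap X Y) with (interchange X X Y Y).
rewrite bimap_comp, comp_assoc.
rewrite <- (comp_assoc (fwd (ρ X) ⊠ fwd (λ Y))), <- interchange_nat.
rewrite (interchange_unit _ _ swap_unit), comp_id_l.
rewrite <- !bimap_comp.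
now rewrite copy_counit_r, copy_counit_l, bimap_id.
Qed.

Lemma deterministic_pairing (V X Y : C) (p : hom V (X ⊗ Y)) :
  deterministic p ->
  p = ((marginal_l X Y ∘ p) ⊠ (marginal_r X Y ∘ p)) ∘ copy V.
Proof.
intros [_ cp].
now rewrite bimap_comp, <- comp_assoc, <- cp, comp_assoc, marginals_copy, comp_id_l.
Qed.

Lemma copyable_tensor (X Y X' Y' : C) (f : hom X Y) (g : hom X' Y') :
  copyable f -> copyable g -> copyable (f ⊠ g).
Proof.
unfold copyable; intros cf cg; rewrite !copy_tens.
change (middle_swap X X') with (interchange X X X' X').
change (middle_swap Y Y') with (interchange Y Y Y' Y').
rewrite <- comp_assoc, <- bimap_comp, cf, cg, bimap_comp.
now rewrite !comp_assoc, interchange_nat.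
Qed.
End Marginals.

Lemma marginal_l_nat (C : MarkovCategory) (X Y X' Y' : C)
    (f : hom X X') (g : hom Y Y') :
  marginal_l X' Y' ∘ (f ⊠ g) = f ∘ marginal_l X Y.
Proof.
unfold marginal_l.
rewrite <- comp_assoc, <- bimap_comp, comp_id_l, (all_total g : del _ ∘ g = _).
rewrite comp_assoc; unfold ρ; rewrite <- runit_nat.
now rewrite <- comp_assoc, <- bimap_comp, comp_id_l, comp_id_r.
Qed.

Lemma marginal_r_nat (C : MarkovCategory) (X Y X' Y' : C)
    (f : hom X X') (g : hom Y Y') :
  marginal_r X' Y' ∘ (f ⊠ g) = g ∘ marginal_r X Y.
Proof.
unfold marginal_r.
rewrite <- comp_assoc, <- bimap_comp, comp_id_l, (all_total f : del _ ∘ f = _).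
rewrite comp_assoc; unfold λ; rewrite <- lunit_nat.
now rewrite <- comp_assoc, <- bimap_comp, comp_id_l, comp_id_r.
Qed.

(** * Tensor products of pullback squares *)

Section Partializable.
Variable C : MarkovCategory.
Hypothesis HC : partializable C.

Lemma det_mono_tensor : tensor_preserves_det_mono C.
Proof.
intros A X B X' i j hi hj; split; [split|].
- apply all_total.
- apply copyable_tensor; [apply hi|apply hj].
- rewrite <- (comp_id_r i), <- (comp_id_l j), bimap_comp.
  apply is_mono_comp; [|apply is_mono_tensor_swap]; now apply (part_tens_mono HC).
Qed.

Lemma is_pullback_tensor (W A B Y W' A' B' Y' : C)
    (f : hom A Y) (j : hom B Y) (u : hom W A) (v : hom W B)
    (f' : hom A' Y') (j' : hom B' Y') (u' : hom W' A') (v' : hom W' B') :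
  det_mono j -> det_mono j' ->
  is_pullback f j u v -> is_pullback f' j' u' v' ->
  is_pullback (f ⊠ f') (j ⊠ j') (u ⊠ u') (v ⊠ v').
Proof.
intros hj hj' pb pb'.
assert (hu := part_pullback_det HC hj pb).
assert (hu' := part_pullback_det HC hj' pb').
destruct (det_mono_tensor hj hj') as [_ mj].
destruct (det_mono_tensor hu hu') as [_ mu].
destruct pb as [e p], pb' as [e' p'].
assert (E : (f ⊠ f') ∘ (u ⊠ u') = (j ⊠ j') ∘ (v ⊠ v')).
{ now rewrite <- !bimap_comp, e, e'. }
split; [exact E|]; intros V a b h.
(* The leg [r] of an actual pullback is deterministic, unlike [a]. *)
destruct (part_pullback_ex HC (f ⊠ f') (det_mono_tensor hj hj'))
  as [P [r [q pbP]]].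
assert (hr := part_pullback_det HC (det_mono_tensor hj hj') pbP).
destruct pbP as [eP pP].
destruct (p _ (marginal_l _ _ ∘ r) (marginal_l _ _ ∘ q)) as [c1 [[c1u _] _]].
{ rewrite !comp_assoc, <- (marginal_l_nat f f'), <- (marginal_l_nat j j').
  now rewrite <- !comp_assoc, eP. }
destruct (p' _ (marginal_r _ _ ∘ r) (marginal_r _ _ ∘ q)) as [c2 [[c2u _] _]].
{ rewrite !comp_assoc, <- (marginal_r_nat f f'), <- (marginal_r_nat j j').
  now rewrite <- !comp_assoc, eP. }
destruct (pP V a b h) as [d [[da _] _]].
assert (fac : (u ⊠ u') ∘ ((c1 ⊠ c2) ∘ copy P ∘ d) = a).
{ rewrite !comp_assoc, <- bimap_comp, c1u, c2u.
  now rewrite <- (deterministic_pairing (proj1 hr)). }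
exists ((c1 ⊠ c2) ∘ copy P ∘ d); split; [split|].
- exact fac.
- apply mj; now rewrite (comp_assoc (j ⊠ j')), <- E, <- (comp_assoc (f ⊠ f')), fac.
- intros c [ca _]; apply mu; now rewrite fac, ca.
Qed.

(** * The tensor product of partial morphisms *)

Let tspan {X Y X' Y' : C} := @tensor_span C det_mono_tensor X Y X' Y'.

Lemma tensor_span_equiv (X Y X' Y' : C) (s1 s2 : Span X Y) (t1 t2 : Span X' Y') :
  span_equiv s1 s2 -> span_equiv t1 t2 -> span_equiv (tspan s1 t1) (tspan s2 t2).
Proof.
intros [k [k1 k2]] [l [l1 l2]].
unshelve eexists.
{ exists (fwd k ⊠ fwd l) (bwd k ⊠ bwd l).
  - now rewrite <- bimap_comp, !bwd_fwd, bimap_id.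
  - now rewrite <- bimap_comp, !fwd_bwd, bimap_id. }
simpl; now rewrite <- !bimap_comp, k1, k2, l1, l2.
Qed.

Definition ptensor_rel (X Y X' Y' : C) (P : PHom X Y) (Q : PHom X' Y')
    (w : Span (X ⊗ X') (Y ⊗ Y')) : Prop :=
  exists s t, proj1_sig P s /\ proj1_sig Q t /\ span_equiv (tspan s t) w.

Lemma ptensor_rel_cls (X Y X' Y' : C) (s : Span X Y) (t : Span X' Y')
    (w : Span (X ⊗ X') (Y ⊗ Y')) :
  ptensor_rel (cls s) (cls t) w <-> span_equiv (tspan s t) w.
Proof.
split.
- intros [s' [t' [hs [ht hw]]]].
  eapply span_equiv_trans; [|exact hw]; now apply tensor_span_equiv.
- intros hw; exists s, t; repeat split; [apply span_equiv_refl..|exact hw].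
Qed.

Lemma ptensor_class (X Y X' Y' : C) (P : PHom X Y) (Q : PHom X' Y') :
  exists w, ptensor_rel P Q = span_equiv w.
Proof.
destruct (cls_ind P) as [s ->], (cls_ind Q) as [t ->].
exists (tspan s t).
apply FunctionalExtensionality.functional_extensionality; intros w.
apply PropExtensionality.propositional_extensionality, ptensor_rel_cls.
Qed.

Definition ptensor (X Y X' Y' : C) (P : PHom X Y) (Q : PHom X' Y') :
    PHom (X ⊗ X') (Y ⊗ Y') :=
  exist _ (ptensor_rel P Q) (ptensor_class P Q).

Lemma ptensor_cls (X Y X' Y' : C) (s : Span X Y) (t : Span X' Y') :
  ptensor (cls s) (cls t) = cls (tspan s t).
Proof. apply PHom_ext; intros w; apply ptensor_rel_cls. Qed.

Lemma ptensor_incl (X Y X' Y' : C) (f : hom X Y) (g : hom X' Y') :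
  ptensor (cls (incl_span f)) (cls (incl_span g)) = cls (incl_span (f ⊠ g)).
Proof.
rewrite ptensor_cls; apply cls_eq.
exists (Build_Iso (comp_id_l (idm (X ⊗ X'))) (comp_id_l (idm (X ⊗ X')))); simpl.
now rewrite bimap_id, !comp_id_r.
Qed.

Lemma ptensor_comp (X Y Z X' Y' Z' : C)
    (Q : PHom Y Z) (P : PHom X Y) (Q' : PHom Y' Z') (P' : PHom X' Y') :
  ptensor (pcomp HC Q P) (pcomp HC Q' P')
  = pcomp HC (ptensor Q Q') (ptensor P P').
Proof.
destruct (cls_ind P) as [s ->], (cls_ind Q) as [t ->].
destruct (cls_ind P') as [s' ->], (cls_ind Q') as [t' ->].
destruct (is_composite_ex HC s t) as [w h].
destruct (is_composite_ex HC s' t') as [w' h'].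
rewrite (cls_pcomp HC h), (cls_pcomp HC h'), !ptensor_cls.
symmetry; apply cls_pcomp.
destruct h as [u [v [pb [hl hr]]]], h' as [u' [v' [pb' [hl' hr']]]].
exists (u ⊠ u'), (v ⊠ v'); simpl; split; [|split].
- now apply is_pullback_tensor; try apply lleg_det_mono.
- now rewrite hl, hl', bimap_comp.
- now rewrite hr, hr', bimap_comp.
Qed.

Definition partial_tensor : @BifunctorOn (Partial HC) (@tens C) :=
  @Build_FunctorOn (prod_cat (Partial HC) (Partial HC)) (Partial HC)
    (fun p => @tens C (fst p) (snd p))
    (fun p q h => ptensor (fst h) (snd h))
    (fun p => eq_trans (ptensor_incl (idm (fst p : C)) (idm (snd p : C)))
       (f_equal (fun h => cls (incl_span h)) (bimap_id tensor _ _)))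
    (fun p q r g f => ptensor_comp (fst g) (fst f) (snd g) (snd f)).

(** * The symmetric monoidal structure *)

Notation inc f := (cls (incl_span f)).

(** Postcomposing with [inc l] only changes the right leg, and the square formed
    by [k] and [m] is a pullback because these are isomorphisms, so that both
    sides are represented by the span with legs [lleg s] and [l ∘ rleg s]. *)
Lemma incl_nat (X Y X' Y' : C) (s : Span X Y) (t : Span X' Y')
    (k : Iso X X') (l : hom Y Y') (m : Iso (apex s) (apex t)) :
  fwd k ∘ lleg s = lleg t ∘ fwd m -> l ∘ rleg s = rleg t ∘ fwd m ->
  pcomp HC (inc l) (cls s) = pcomp HC (cls t) (inc (fwd k)).
Proof.
intros hl hr.
set (w := {| apex := apex s; lleg := lleg s; rleg := l ∘ rleg s;
             lleg_det_mono := lleg_det_mono s |}).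
transitivity (cls w); [|symmetry]; apply cls_pcomp.
- exists (idm _), (rleg s); simpl; split; [split|].
  + now rewrite comp_id_l, comp_id_r.
  + intros V a b; rewrite comp_id_l; intros h; exists a; split.
    * now rewrite comp_id_l.
    * intros x [hx _]; now rewrite comp_id_l in hx.
  + now rewrite comp_id_r.
- exists (lleg s), (fwd m); simpl; split; [now apply is_pullback_iso|].
  now rewrite comp_id_l.
Qed.

Definition incl_iso (X Y : C) (k : Iso X Y) : @Iso (Partial HC) X Y.
Proof.
exists (inc (fwd k) : @hom (Partial HC) X Y) (inc (bwd k) : @hom (Partial HC) Y X).
- exact (eq_trans (eq_sym (incl_comp HC _ _))
    (f_equal (fun h => inc h) (bwd_fwd k))).
- exact (eq_trans (eq_sym (incl_comp HC _ _))
    (f_equal (fun h => inc h) (fwd_bwd k))).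
Defined.

Definition partial_monoidal :
  @SymMonoidal (Partial HC) (@tens C) partial_tensor (@unit C).
Proof.
unshelve refine (@Build_SymMonoidal (Partial HC) (@tens C) partial_tensor unit
  (fun X Y Z => incl_iso (α X Y Z)) (fun X => incl_iso (λ X))
  (fun X => incl_iso (ρ X)) (fun X Y => inc (σ X Y))
  _ _ _ _ _ _ _ _); unfold bimap; cbn.
- intros X Y Z X' Y' Z' P Q R.
  destruct (cls_ind P) as [s ->], (cls_ind Q) as [t ->], (cls_ind R) as [r ->].
  rewrite !ptensor_cls.
  apply (incl_nat (s := tspan (tspan s t) r) (t := tspan s (tspan t r))
    (k := α _ _ _) (m := α _ _ _)); apply (assoc_nat smc_str).
- intros X Y P; destruct (cls_ind P) as [s ->]; rewrite ptensor_cls.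
  apply (incl_nat (s := tspan (incl_span (idm unit)) s) (t := s)
    (k := λ _) (m := λ _)); apply (lunit_nat smc_str).
- intros X Y P; destruct (cls_ind P) as [s ->]; rewrite ptensor_cls.
  apply (incl_nat (s := tspan s (incl_span (idm unit))) (t := s)
    (k := ρ _) (m := ρ _)); apply (runit_nat smc_str).
- intros X Y X' Y' P Q.
  destruct (cls_ind P) as [s ->], (cls_ind Q) as [t ->]; rewrite !ptensor_cls.
  pose (iso (A B : C) := Build_Iso (swap_swap smc_str A B) (swap_swap smc_str B A)
    : Iso (A ⊗ B) (B ⊗ A)).
  apply (incl_nat (s := tspan s t) (t := tspan t s)
    (k := iso _ _) (m := iso _ _)); apply (swap_nat smc_str).
- intros W X Y Z.
  rewrite !ptensor_incl, <- !incl_comp; f_equal; f_equal.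
  apply (pentagon smc_str).
- intros X Y.
  rewrite !ptensor_incl, <- !incl_comp; f_equal; f_equal.
  apply (triangle smc_str).
- intros X Y.
  rewrite <- !incl_comp; f_equal; f_equal.
  apply (swap_swap smc_str).
- intros X Y Z.
  rewrite !ptensor_incl, <- !incl_comp; f_equal; f_equal.
  apply (hexagon smc_str).
Defined.

Lemma partial_monoidal_extends : extends_along_incl partial_monoidal.
Proof.
split; try reflexivity.
intros X Y X' Y' f g; symmetry; apply ptensor_incl.
Qed.

End Partializable.

Theorem proposition3p17 (C : MarkovCategory) (HC : partializable C) :
  exists H : tensor_preserves_det_mono C,
    (forall (X Y X' Y' : C) (s1 s2 : Span X Y) (t1 t2 : Span X' Y'),
       span_equiv s1 s2 -> span_equiv t1 t2 ->
       span_equiv (tensor_span H s1 t1) (tensor_span H s2 t2)) /\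
    exists T : @BifunctorOn (Partial HC) (@tens C),
      (forall (X Y X' Y' : C) (s : Span X Y) (t : Span X' Y'),
         @bimap (Partial HC) (@tens C) T X Y X' Y' (cls s) (cls t)
         = cls (tensor_span H s t)) /\
      exists M : @SymMonoidal (Partial HC) (@tens C) T (@unit C),
        extends_along_incl M.
Proof.
exists (det_mono_tensor HC); split.
- exact (tensor_span_equiv HC).
- exists (partial_tensor HC); split.
  + exact (ptensor_cls HC).
  + exists (partial_monoidal HC); apply partial_monoidal_extends.
Qed.
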